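(* Let $A$ be an algebra over a field $F$ with $\mathrm{char}(F)\neq 2$, let $X$ be an arbitrary vector space over $F$, and let $\Phi:A\times A\to X$ be a skew-symmetric bilinear map satisfying $$\Phi(x^2,x)=0\quad\text{for all } x\in A.$$ Then $$\Phi(xy,u)+\Phi(ux,y)+\Phi(yu,x)=0$$ for all $u\in \mathrm{Alg}([[A,A],[A,A]])$ and all $x,y\in A$.
   Context: Algebras are associative and not necessarily unital. For $x,y\in A$, $[x,y]=xy-yx$. $\mathrm{Alg}([[A,A],[A,A]])$ denotes the subalgebra of $A$ generated (without adjoining a unit) by all elements of the form $[[x,y],[z,w]]$ with $x,y,z,w\in A$. A bilinear map $\Phi$ is skew-symmetric if $\Phi(x,y)=-\Phi(y,x)$ for all $x,y\in A$. *)

(* Defs.v *)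
From mathcomp Require Import all_boot all_algebra.

Set Implicit Arguments.
Unset Strict Implicit.
Unset Printing Implicit Defensive.

Import GRing.Theory.
Local Open Scope ring_scope.

(* MathComp's rings and algebras all have a unit, so a not necessarily unital
   F-algebra is a vector space A with a bilinear product mul : A -> A -> A
   (and associative mul as a separate hypothesis). *)

Definition bracket (F : fieldType) (A : lmodType F)
    (mul : {bilinear A -> A -> A}) (x y : A) : A :=
  mul x y - mul y x.

Record is_subalgebra (F : fieldType) (A : lmodType F)
    (mul : {bilinear A -> A -> A}) (S : A -> Prop) : Prop := IsSubalgebra {
  subalgebra0 : S 0;
  subalgebraD : forall x y, S x -> S y -> S (x + y);
  subalgebraZ : forall (a : F) x, S x -> S (a *: x);
  subalgebraM : forall x y, S x -> S y -> S (mul x y)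
}.

Definition subalgebra_gen (F : fieldType) (A : lmodType F)
    (mul : {bilinear A -> A -> A}) (G : A -> Prop) (u : A) : Prop :=
  forall S : A -> Prop,
    is_subalgebra mul S -> (forall g, G g -> S g) -> S u.

Definition double_bracket (F : fieldType) (A : lmodType F)
    (mul : {bilinear A -> A -> A}) (u : A) : Prop :=
  exists x y z w : A, u = bracket mul (bracket mul x y) (bracket mul z w).

(* Main.v *)
(** Let T(x, y, z) = Phi(xy, z) + Phi(yz, x) + Phi(zx, y). Linearizing
    Phi(x^2, x) = 0 shows that T is alternating, and T is a Hochschild cocycle,
    T(xy, z, w) - T(yz, w, x) + T(zw, x, y) - T(wx, y, z) = 0, so its kernel
    in the first argument is a subalgebra. Skew-symmetrizing the cocycle
    identity gives T([x, y], z, w) = - T([z, w], x, y); with the Jacobi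
    identity this forces T to vanish on triples of commutators, and then
    T([[x, y], [z, w]], p, q) = - T([p, q], [x, y], [z, w]) = 0. *)

Require Import Defs.
From mathcomp Require Import all_boot all_algebra.

Import GRing.Theory.
Local Open Scope ring_scope.

Section CyclicCoboundary.

Context {F : fieldType} {A : lmodType F} (mul : {bilinear A -> A -> A}).
Context {X : lmodType F} (Phi : {bilinear A -> A -> X}).

Definition cyclic_sum (x y z : A) : X :=
  Phi (mul x y) z + Phi (mul y z) x + Phi (mul z x) y.

Local Notation T := cyclic_sum.

Lemma cyclic_sumC x y z : T x y z = T y z x.
Proof. by rewrite /T -addrA addrC. Qed.

Lemma cyclic_sumDl x x' y z : T (x + x') y z = T x y z + T x' y z.
Proof.
rewrite /T !(linearDl, linearDr) /=.
by rewrite (addrACA (Phi (mul x y) z)) [LHS]addrACA.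
Qed.

Lemma cyclic_sumZl a x y z : T (a *: x) y z = a *: T x y z.
Proof. by rewrite /T !(linearZl_LR, linearZr) /= !scalerDr. Qed.

Hypothesis mulA : associative mul.
Hypothesis Phi_skew : forall x y, Phi x y = - Phi y x.

(* cyclic_sum is the Hochschild coboundary of the cyclic cochain
   Phi, hence a cyclic cocycle. *)
Lemma cyclic_sum_cocycle x y z w :
  T (mul x y) z w - T (mul y z) w x + T (mul z w) x y - T (mul w x) y z = 0.
Proof.
rewrite /T !mulA !opprD !addrA.
(* Associativity alone cancels in pairs the eight terms with a triple product; the four terms
   pairing two double products need skew-symmetry. *)
rewrite (Phi_skew (mul z w) (mul x y)) (Phi_skew (mul w x) (mul y z)) !opprK.
rewrite [LHS](ACl ((1*6)*(8*2)*(3*10)*(9*4)*(5*11)*(7*12)))/=.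
by rewrite !subrr !addr0.
Qed.

Hypothesis Phi_sq : forall x, Phi (mul x x) x = 0.

(** Polarization of [Phi_sq]: the part of [Phi (mul s s) s] at [s = x + y + z] that is linear in
    each of [x], [y], [z] is [T x y z + T y x z]. *)
Lemma cyclic_sum_skewl x y z : T x y z = - T y x z.
Proof.
(* [p u v] is the part of [Phi (mul s s) s] at [s = u + v] that is quadratic in [u] and linear in
   [v]. *)
pose p u v := Phi (mul u u) v + Phi (mul u v + mul v u) u.
have p_skew u v : p u v + p v u = 0.
  rewrite -[RHS](Phi_sq (u + v)).
  rewrite /p !(linearDl, linearDr) /= !Phi_sq !addrA add0r addr0.
  by rewrite [LHS](ACl (2*3*4*1*6*5)).
have p_add : p (x + y) z + p z (x + y) =
    p x z + p z x + (p y z + p z y) + (T x y z + T y x z).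
  rewrite /p /T !(linearDl, linearDr) /= !addrA.
  by rewrite [LHS](ACl (1*5*9*13*15*17*4*8*12*14*16*18*2*6*11*3*7*10)).
by move: p_add; rewrite !p_skew !add0r => /esym/eqP; rewrite addr_eq0 => /eqP.
Qed.

End CyclicCoboundary.

Section AlternatingCocycle.

Context {F : fieldType} {A : lmodType F} {mul : {bilinear A -> A -> A}}.
Context {X : lmodType F} (T : A -> A -> A -> X).
Local Notation "[ x , y ]" := (bracket mul x y) : ring_scope.

Hypothesis charF : 2%N \notin [pchar F].
Hypothesis mulA : associative mul.
Hypothesis TC : forall x y z, T x y z = T y z x.
Hypothesis TDl : forall x x' y z, T (x + x') y z = T x y z + T x' y z.
Hypothesis TZl : forall a x y z, T (a *: x) y z = a *: T x y z.
Hypothesis T_skewl : forall x y z, T x y z = - T y x z.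
Hypothesis T_cocycle : forall x y z w,
  T (mul x y) z w - T (mul y z) w x + T (mul z w) x y - T (mul w x) y z = 0.

Let TBl x x' y z : T (x - x') y z = T x y z - T x' y z.
Proof. by rewrite -scaleN1r TDl TZl scaleN1r. Qed.

Let T0l y z : T 0 y z = 0.
Proof. by rewrite -(subrr 0) TBl subrr. Qed.

Let T_skewr x y z : T x y z = - T x z y.
Proof. by rewrite TC T_skewl -TC. Qed.

Lemma mulr2n_eq0 (v : X) : v *+ 2 = 0 -> v = 0.
Proof.
have two_neq0 : (2%:R : F) != 0 by move: charF; rewrite inE.
by move/eqP; rewrite -scaler_nat scaler_eq0 (negPf two_neq0) => /eqP.
Qed.

Let b x y z w := T [x, y] z w + T [z, w] x y.

Lemma sum_cocycles x y z w :
  b x y z w *+ 2 + b y z x w + b z x y w = 0.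
Proof.
pose C p q r s :=
  T (mul p q) r s - T (mul q r) s p + T (mul r s) p q - T (mul s p) q r.
(* Skew-symmetrizing in [x], [y] and in [z], [w] doubles the terms of [b x y z w]; the remaining
   terms form the two other values of [b]. *)
have <- : C x y z w - C y x z w - C x y w z + C y x w z = 0.
  by rewrite /C !T_cocycle !subr0 addr0.
rewrite /C.
rewrite (T_skewr _ w x) (T_skewr _ w y).
rewrite !(T_skewr _ w z) !(T_skewr _ y x).
rewrite (T_skewr _ z y) (T_skewr _ x z).
rewrite /b /bracket !TBl mulr2n !opprD !opprK !addrA.
by rewrite [RHS](ACl (1*5*3*11*9*13*7*15*2*16*14*4*12*6*10*8)).
Qed.

(* Subtracting the cyclic rotations of [sum_cocycles] shows that the three
   values of [b] coincide, so that four times each of them vanishes. *)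
Lemma bracket_skew x y z w : T [x, y] z w = - T [z, w] x y.
Proof.
apply/eqP; rewrite -addr_eq0 -/(b x y z w).
have E1 := sum_cocycles x y z w; have E2 := sum_cocycles y z x w.
have E3 := sum_cocycles z x y w.
move: E1 E2 E3; set b1 := b x y z w; set b2 := b y z x w; set b3 := b z x y w.
have eq_of p q r : p *+ 2 + q + r = 0 -> q *+ 2 + r + p = 0 -> p = q :> X.
  rewrite !mulr2n => E1 E2; apply: (addrI (p + q + r)).
  by rewrite [LHS](ACl (1*4*2*3)) [RHS](ACl (2*4*3*1))/= E1 E2.
move=> E1 E2 E3; have e12 := eq_of _ _ _ E1 E2; have e23 := eq_of _ _ _ E2 E3.
apply/eqP; do 2!apply: mulr2n_eq0.
by rewrite -[RHS]E1 -e23 -e12 !mulr2n addrA.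
Qed.

Lemma bracket_bracketr x y z :
  [x, [y, z]] = [[x, y], z] - [[x, z], y].
Proof.
rewrite /bracket !(linearBl, linearBr) /= !mulA !opprB !opprD !opprK !addrA.
by rewrite [RHS](ACl (1*5*3*7*(8*2)*(6*4)))/= !subrr !addr0.
Qed.

(* By the Jacobi identity the left-hand side is invariant under exchanging
   (x, y) and (z, w), but it also changes sign. *)
Lemma brackets_eq0 x y c d z w : T [x, y] [c, d] [z, w] = 0.
Proof.
pose S x y p z w q := T [[x, y], p] [z, w] q.
have S_skew x' y' p z' w' q : S x' y' p z' w' q = - S z' w' q x' y' p.
  by rewrite /S bracket_skew.
(* [bracket_skew] gathers [[x', y']] and [[c, d]] into one bracket, the Jacobi identity splits it,
   and [bracket_skew] then restores [[z', w']]. *)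
have TE x' y' z' w' :
    T [x', y'] [c, d] [z', w'] = S x' y' d z' w' c - S x' y' c z' w' d.
  rewrite -TC bracket_skew bracket_bracketr TBl opprB /S.
  by rewrite 2![T [[_, _], _] _ _]bracket_skew -2!(T_skewl [_, _]).
apply: mulr2n_eq0; rewrite mulr2n.
have {1}-> : T [x, y] [c, d] [z, w] = T [z, w] [c, d] [x, y].
  by rewrite !TE (S_skew x y d) (S_skew x y c) opprK addrC.
by rewrite T_skewl -(TC [x, y]) addNr.
Qed.

Lemma left_kernel_subalgebra :
  is_subalgebra mul (fun u => forall x y, T u x y = 0).
Proof.
split=> [x y|v w v0 w0 x y|a v v0 x y|v w v0 w0 x y].
- by rewrite T0l.
- by rewrite TDl v0 w0 addr0.
- by rewrite TZl v0 scaler0.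
(* Each term other than [T (mul v w) x y] has [v] or [w] alone as an argument, and cyclicity brings
   it to the first place. *)
have := T_cocycle v w x y.
by rewrite -(TC v (mul w x)) v0 (TC _ v) v0 (TC _ w) w0 !subr0 addr0.
Qed.

Lemma subalgebra_gen_left_kernel u :
  subalgebra_gen mul (double_bracket mul) u -> forall x y, T u x y = 0.
Proof.
move/(_ _ left_kernel_subalgebra); apply=> _ [p [q [r [s ->]]]] x y.
by rewrite bracket_skew brackets_eq0 oppr0.
Qed.

End AlternatingCocycle.

Theorem theorem2p1 (F : fieldType) (charF : 2%N \notin [pchar F])
    (A : lmodType F) (mul : {bilinear A -> A -> A}) (mulA : associative mul)
    (X : lmodType F) (Phi : {bilinear A -> A -> X})
    (Phi_skew : forall x y : A, Phi x y = - Phi y x)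
    (Phi_sq : forall x : A, Phi (mul x x) x = 0) :
  forall u : A, subalgebra_gen mul (double_bracket mul) u ->
  forall x y : A,
    Phi (mul x y) u + Phi (mul u x) y + Phi (mul y u) x = 0.
Proof.
move=> u uS x y; rewrite addrAC -/(cyclic_sum mul Phi x y u) -cyclic_sumC.
apply: subalgebra_gen_left_kernel uS x y => //.
- exact: cyclic_sumC.
- exact: cyclic_sumDl.
- exact: cyclic_sumZl.
- exact: cyclic_sum_skewl.
- exact: cyclic_sum_cocycle.
Qed.
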